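(* Suppose that $f(s)=\sum_{n=1}^\infty a_n n^{-s}$ is in $\mathscr{H}^2$. Then $$\left(\frac{1}{\pi}\int_{-\infty}^\infty \left|f\left(1/2+it\right)\right|^2\,\frac{dt}{1+t^2}\right)^{\frac12} < \sqrt{2}\,\|f\|_{\mathscr{H}^2},$$ and the constant $\sqrt{2}$ is optimal, in the sense that if $C$ is a constant such that $$\left(\frac{1}{\pi}\int_{-\infty}^\infty \left|f\left(1/2+it\right)\right|^2\,\frac{dt}{1+t^2}\right)^{\frac12} \le C\,\|f\|_{\mathscr{H}^2}$$ for every $f\in\mathscr{H}^2$, then $C\ge\sqrt{2}$.
   Context: $\mathscr{H}^2$ denotes the Hardy--Hilbert space of Dirichlet series $f(s)=\sum_{n=1}^\infty a_n n^{-s}$ with complex, square summable coefficients, with norm $\|f\|_{\mathscr{H}^2}:=\left(\sum_{n=1}^\infty |a_n|^2\right)^{1/2}$. By the Cauchy--Schwarz inequality, every $f\in\mathscr{H}^2$ converges absolutely in the half-plane $\mathbb{C}_{1/2}=\{s\in\mathbb{C}:\Re(s)>1/2\}$. On the line $\Re(s)=1/2$, $f(1/2+it)$ is understood as the boundary value of $f$ in the sense of the conformally invariant Hardy space of $\mathbb{C}_{1/2}$, into which $\mathscr{H}^2$ embeds.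
   Formalization: The strict inequality is stated only for f not identically zero, since for f = 0 both sides equal 0 and the strict inequality fails. *)

(* Defs.v *)
From HB Require Import structures.
From mathcomp Require Import all_boot all_order all_algebra.
From mathcomp Require Import complex.
From mathcomp Require Import all_classical all_reals all_analysis.

Set Implicit Arguments.
Unset Strict Implicit.
Unset Printing Implicit Defensive.

Import Order.TTheory GRing.Theory Num.Theory.
Import numFieldNormedType.Exports.

Local Open Scope classical_set_scope.
Local Open Scope complex_scope.
Local Open Scope ring_scope.

(* [R[i]] with the topology of its modulus, like any other numFieldType. *)
HB.instance Definition _ (R : realType) := NormedModule.copy R[i] R[i]^o.

Definition cexp (R : realType) (z : R[i]) : R[i] :=
  (expR (complex.Re z) * cos (complex.Im z))
    +i* (expR (complex.Re z) * sin (complex.Im z)).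

(* [n ^ (- s)]; only used for [0 < n], since [ln 0 = 0]. *)
Definition natcpowN (R : realType) (n : nat) (s : R[i]) : R[i] :=
  cexp (- (s * (ln (n%:R : R))%:C)).

(* A Dirichlet series is given by its coefficients [a 1], [a 2], etc.;
   the value [a 0] is never used.  [dirichlet a s] is meaningful where the
   series converges, in particular for [1/2 < Re s] when [a] is in H^2. *)
Definition dirichlet (R : realType) (a : nat -> R[i]) (s : R[i]) : R[i] :=
  limn (fun N : nat => \sum_(1 <= n < N) a n * natcpowN n s).

Definition H2_sqnorm (R : realType) (a : nat -> R[i]) : \bar R :=
  (\sum_(1 <= n <oo) (complex.Re `|a n| ^+ 2)%:E)%E.

Definition H2 (R : realType) (a : nat -> R[i]) : Prop :=
  (H2_sqnorm a < +oo)%E.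

Definition H2_norm (R : realType) (a : nat -> R[i]) : \bar R :=
  sqrte (H2_sqnorm a).

Definition critical_point (R : realType) (t : R) : R[i] := 2^-1 +i* t.

Definition stolz_angle (R : realType) (M t : R) : set R[i] :=
  [set s | 2^-1 < complex.Re s /\
           `|complex.Im s - t| < M * (complex.Re s - 2^-1)].

Definition nontangential_limit (R : realType) (f : R[i] -> R[i]) (t : R)
    (l : R[i]) : Prop :=
  forall M : R, 0 < M ->
    f s @[s --> within (stolz_angle M t) (nbhs (critical_point t))] --> l.

(* The boundary value at [1/2 + i t] of a function on the half-plane
   [1/2 < Re s]: its nontangential limit, a notion which is invariant under
   conformal maps onto the unit disc.  For a function in the conformally
   invariant Hardy space, the limit exists for almost every [t] (Fatou), so
   the default value [0] is only taken on a null set. *)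
Definition boundary_value (R : realType) (f : R[i] -> R[i]) (t : R) : R[i] :=
  xget 0 [set l | nontangential_limit f t l].

(* The integral is that of a nonnegative function, with values in [0, +oo]. *)
Definition boundary_norm (R : realType) (f : R[i] -> R[i]) : \bar R :=
  sqrte ((pi^-1)%:E *
    \int[@lebesgue_measure R]_t
      (complex.Re `|boundary_value f t| ^+ 2 / (1 + t ^+ 2))%:E)%E.

(* Main.v *)
Require Import Defs.
From mathcomp Require Import all_boot all_order all_algebra.
From mathcomp Require Import complex ring lra.
From mathcomp Require Import all_classical all_reals all_analysis.
From mathcomp Require Import measurable_realfun.
Import Order.TTheory GRing.Theory Num.Theory.
Import numFieldNormedType.Exports.
Local Open Scope ring_scope.

(* Since [1/pi] times the integral of [cos (x t) / (1 + t^2)] is [exp (- |x|)],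
   the weighted square norm of a Dirichlet polynomial on the critical line is the
   quadratic form of the kernel [sqrt (m n) / max (m, n)^2].  The Schur test with
   weights [n^(-1/2)] bounds its [m]-th row by [1 + m * sum_(n > m) 1/n^2], which
   is less than [2 - 1/(2m+1)]: this gives the strict inequality, and
   [a_n = n^(-1/2)] for [n <= N] gives the ratio [2 - O(1 / log N)].
   For a general series, only an upper bound of the boundary values is needed:
   Fatou's lemma, applied to the partial sums and then to [Re s -> 1/2], reduces
   it to Dirichlet polynomials. *)

Set Implicit Arguments.
Unset Strict Implicit.
Unset Printing Implicit Defensive.

(** * The Fourier transform of [1 / (1 + t^2)] *)

Section real_integrals.
Local Open Scope classical_set_scope.
Context {R : realType}.
Implicit Types (f g : R -> R) (e k u c x y t : R).
Let mu := @lebesgue_measure R.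

(** The line is cut at [0] and its negative half reflected. This removes the absolute values [|t|]
    from the integrands below and cancels their odd parts. *)
Lemma ge0_integralT_fold f : continuous f -> (forall x, 0 <= f x) ->
  (\int[mu]_x (f x)%:E = \int[mu]_(x in `[0%R, +oo[) (f x + f (- x))%:E)%E.
Proof.
move=> cf f0.
have mf : measurable_fun [set: R] f by exact: continuous_measurable_fun.
have mposnums : measurable [set x : R | 0 <= x] by rewrite -set_itvcy.
rewrite -(setUv [set x : R | 0 <= x]) ge0_integral_setU//=; last 4 first.
  exact: measurableC.
  by apply/measurable_EFinP; rewrite setUv.
  by move=> x _; rewrite lee_fin.
  exact/disj_setPCl.
rewrite -set_itvcy// setCitvr.
rewrite integral_itv_bndo_bndc; last exact/measurable_EFinP/measurable_funTS.
rewrite -{2}oppr0 ge0_integration_by_substitutionNy//; last 1 first.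
  exact: continuous_subspaceT.
rewrite -ge0_integralD//=.
- by move=> x _; rewrite lee_fin.
- exact/measurable_EFinP/measurable_funTS.
- by move=> x _; rewrite lee_fin.
- apply/measurable_EFinP/measurable_funTS.
  by apply: measurableT_comp => //; exact: oppr_measurable.
Qed.

Lemma ge0_1DMcos k x : `|k| <= 1 -> 0 <= 1 + k * cos x.
Proof.
move=> k1; have : `|k * cos x| <= 1.
  by rewrite normrM mulr_ile1// ler_norml cos_geN1 cos_le1.
by rewrite ler_norml => /andP[+ _]; lra.
Qed.

(** An explicit antiderivative exists. The condition on [k] keeps the integrand nonnegative, as the
    fundamental theorem of calculus on a half-line requires, and [k] will later absorb a phase
    [cos c]. *)
Lemma laplace_cos e k u : 0 < e -> `|k| <= 1 ->
  (\int[mu]_(t in `[0%R, +oo[) (expR (- (e * t)) * (1 + k * cos (u * t)))%:E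
   = (e^-1 + k * (e / (e ^+ 2 + u ^+ 2)))%:E)%E.
Proof.
move=> e0 k1.
have d0 : e ^+ 2 + u ^+ 2 != 0.
  by rewrite gt_eqF// ltr_pwDl ?sqr_ge0// exprn_gt0.
(* The antiderivative that vanishes at infinity, so the integral is [- F 0]. *)
pose F t : R := expR (- (e * t)) * (- e^-1 + k / (e ^+ 2 + u ^+ 2) *
   (u * sin (u * t) - e * cos (u * t))).
have dF t : is_derive t 1 F (expR (- (e * t)) * (1 + k * cos (u * t))).
  rewrite /F; apply: is_derive_eq; rewrite /GRing.scale /=.
  by field; rewrite d0 gt_eqF.
have cF : continuous F.
  move=> t; apply/differentiable_continuous/derivable1_diffP; exact: ex_derive.
rewrite (@ge0_continuous_FTC2y _ _ F 0 0).
- rewrite /F !mulr0 oppr0 expR0 sin0 cos0 mulr0 sub0r mulr1 mul1r sub0e.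
  by rewrite -EFinN; congr EFin; field; rewrite d0 gt_eqF.
- by move=> t _; rewrite mulr_ge0 ?expR_ge0// ge0_1DMcos.
- apply: continuous_subspaceT => t.
  by apply/differentiable_continuous/derivable1_diffP; exact: ex_derive.
- apply/norm_cvg0P.
  (* [M] bounds the trigonometric factor of [F] uniformly in [t]. *)
  pose M := e^-1 + `|k / (e ^+ 2 + u ^+ 2)| * (`|u| + e).
  apply: (@squeeze_cvgr _ _ _ _ (cst 0) (fun t => expR (- (e * t)) * M)).
  + near=> t; rewrite normr_ge0/= /F normrM (ger0_norm (expR_ge0 _)).
    rewrite ler_wpM2l ?expR_ge0//.
    apply: (le_trans (ler_normD _ _)); rewrite lerD//.
      by rewrite normrN ger0_norm ?invr_ge0 ?(ltW e0).
    rewrite normrM ler_wpM2l//.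
    apply: (le_trans (ler_normB _ _)); rewrite !normrM lerD//.
      by rewrite ler_piMr// ler_norml sin_geN1 sin_le1.
    by rewrite gtr0_norm// ler_piMr ?(ltW e0)// ler_norml cos_geN1 cos_le1.
  + exact: cvg_cst.
  + rewrite -(mul0r M); apply: cvgM; last exact: cvg_cst.
    apply: (cvg_comp (fun t => e * t) (fun t => expR (- t))); last exact: cvgr_expR.
    by apply: gt0_cvgMry => //; exact: cvg_id.
- by move=> t _; exact: ex_derive.
- by apply: cvg_at_right_filter; exact: cF.
- by move=> t _; rewrite derive1E; exact: derive_val.
Unshelve. all: by end_near. Qed.

Lemma ge0_integralZl_continuous (D : set R) k f : measurable D -> 0 <= k ->
  continuous f -> (forall t, 0 <= f t) ->
  (\int[mu]_(t in D) (k * f t)%:E = k%:E * \int[mu]_(t in D) (f t)%:E)%E.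
Proof.
move=> mD k0 cf f0; under eq_integral do rewrite EFinM.
rewrite ge0_integralZl//.
- by apply/measurable_EFinP/measurable_funTS; exact: continuous_measurable_fun.
- by move=> t _; rewrite lee_fin.
Qed.

Lemma continuous_expRN_norm e : continuous (fun t : R => expR (- (e * `|t|))).
Proof.
move=> t; apply: (cvg_comp (fun t : R => - (e * `|t|)) expR); last first.
  exact: continuous_expR.
by apply: cvgN; apply: cvgMl_tmp; apply: cvg_norm; exact: cvg_id.
Qed.

Lemma continuous_1DMcos k u c : continuous (fun t : R => 1 + k * cos (u * t + c)).
Proof.
move=> t.
by apply/differentiable_continuous/derivable1_diffP; exact: ex_derive.
Qed.

(** Folding adds [cos (u t + c)] and [cos (- u t + c)]; the sine parts cancel and
    [2 cos c cos (u t)] is left, which is [laplace_cos] with [k cos c] in place of [k]. *)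
Lemma integral_expRN_norm_cos e k u c : 0 < e -> `|k| <= 1 ->
  (\int[mu]_t (expR (- (e * `|t|)) * (1 + k * cos (u * t + c)))%:E
   = (2 / e + k * cos c * (2 * e / (e ^+ 2 + u ^+ 2)))%:E)%E.
Proof.
move=> e0 k1.
rewrite ge0_integralT_fold; first last.
- by move=> t; rewrite mulr_ge0 ?expR_ge0// ge0_1DMcos.
- move=> t; apply: cvgM; first exact: continuous_expRN_norm.
  exact: continuous_1DMcos.
have kc1 : `|k * cos c| <= 1.
  by rewrite normrM mulr_ile1// ler_norml cos_geN1 cos_le1.
under eq_integral => t.
  rewrite inE/= in_itv/= andbT => t0.
  rewrite normrN ger0_norm// mulrN cosD [cos (- _ + _)]cosD cosN sinN.
  rewrite [X in X%:E](_ : _ =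
    2 * (expR (- (e * t)) * (1 + k * cos c * cos (u * t)))); last by ring.
  over.
rewrite ge0_integralZl_continuous//; last 2 first.
- by move=> t; apply/differentiable_continuous/derivable1_diffP; exact: ex_derive.
- by move=> t; rewrite mulr_ge0 ?expR_ge0 ?ge0_1DMcos.
rewrite laplace_cos// -EFinM; congr EFin; field.
by rewrite !gt_eqF// ltr_pwDl ?sqr_ge0// exprn_gt0.
Qed.

(* Tonelli's theorem for [exp (- e |t|) exp (- |y|) (1 + cos (t (y - x)))]; the
   [1 +] makes the integrand nonnegative. *)
Lemma integral_expRN_norm_swap e x : 0 < e ->
  (\int[mu]_t (expR (- (e * `|t|)) * (2 + cos (x * t) * (2 / (1 + t ^+ 2))))%:E
   = \int[mu]_y (expR (- `|y|) * (2 / e + 2 * e / (e ^+ 2 + (y - x) ^+ 2)))%:E)%E.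
Proof.
move=> e0.
pose f (z : R * R) := (expR (- (e * `|z.1|)) * expR (- (1 * `|z.2|))
   * (1 + 1 * cos (z.1 * (z.2 - x))))%:E.
have mf : measurable_fun [set: R * R] f.
  apply/measurable_EFinP; apply: measurable_funM.
    apply: measurable_funM.
      apply: (measurableT_comp (f := fun t : R => expR (- (e * `|t|)))) => //.
      by apply: continuous_measurable_fun; exact: continuous_expRN_norm.
    apply: (measurableT_comp (f := fun t : R => expR (- (1 * `|t|)))) => //.
    by apply: continuous_measurable_fun; exact: continuous_expRN_norm.
  apply: measurable_funD => //; apply: measurable_funM => //.
  apply: (measurableT_comp (f := cos)) => //.
    by apply: continuous_measurable_fun; exact: continuous_cos.
  by apply: measurable_funM => //; apply: measurable_funB.
have f0 z : (0 <= f z)%E.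
  by rewrite lee_fin !mulr_ge0 ?expR_ge0// ge0_1DMcos// normr1.
have cE e' u c : continuous (fun t : R => expR (- (e' * `|t|)) *
    (1 + 1 * cos (u * t + c))).
  by move=> t; apply: cvgM; [exact: continuous_expRN_norm|exact: continuous_1DMcos].
have E0 e' u c (t : R) : 0 <= expR (- (e' * `|t|)) * (1 + 1 * cos (u * t + c)).
  by rewrite mulr_ge0 ?expR_ge0 ?ge0_1DMcos ?normr1.
(* The inner integral over [y] has rate [1], frequency [t] and phase [- t x]; the one over [t] has
   rate [e], frequency [y - x] and phase [0]. *)
have := @fubini_tonelli _ _ _ _ R mu mu f mf f0.
under eq_integral => t _.
  under eq_integral => y _.
    rewrite /f /= mulrBr -mulrA.
    over.
  rewrite (ge0_integralZl_continuous _ (expR_ge0 _) (cE _ _ _) (E0 _ _ _))//.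
  rewrite integral_expRN_norm_cos ?normr1// -EFinM cosN.
  rewrite expr1n divr1 !mul1r !mulr1 (mulrC t).
  over.
move=> ->; apply: eq_integral => y _.
under eq_integral => t _.
  rewrite /f /= (mulrC (expR _)) -mulrA (mulrC t) -(addr0 (_ * t)).
  over.
rewrite (ge0_integralZl_continuous _ (expR_ge0 _) (cE _ _ _) (E0 _ _ _))//.
by rewrite integral_expRN_norm_cos ?normr1// -EFinM cos0 !mul1r.
Qed.

Lemma measurable_oneDsqrV : measurable_fun setT (fun t : R => (1 + t ^+ 2)^-1).
Proof. exact: continuous_measurable_fun (@continuous_oneDsqrV R). Qed.

Lemma integral_oneDsqrV : (\int[mu]_t ((1 + t ^+ 2)^-1)%:E = pi%:E)%E.
Proof.
rewrite ge0_symfun_integralT; first last.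
- by move=> t /=; rewrite sqrrN.
- exact: continuous_oneDsqrV.
- by move=> t; rewrite invr_ge0 addr_ge0 ?sqr_ge0.
rewrite -set_itvcy integral0y_oneDsqr -EFinM; congr EFin.
by rewrite mulrCA divff// mulr1.
Qed.

Lemma integrable_oneDsqrV :
  mu.-integrable setT (fun t : R => ((1 + t ^+ 2)^-1)%:E).
Proof.
apply/integrableP; split.
  by apply/measurable_EFinP; exact: measurable_oneDsqrV.
under eq_integral => t _.
  rewrite gee0_abs ?lee_fin ?invr_ge0 ?addr_ge0 ?sqr_ge0//.
  over.
by rewrite integral_oneDsqrV ltry.
Qed.

Lemma integrable_oneDsqr f : measurable_fun setT f -> (forall t, `|f t| <= 1) ->
  mu.-integrable setT (fun t => (f t / (1 + t ^+ 2))%:E).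
Proof.
move=> mf f1; apply: le_integrable integrable_oneDsqrV => //.
  apply/measurable_EFinP; apply: measurable_funM => //.
  exact: measurable_oneDsqrV.
move=> t _; rewrite lee_fin normrM ler_piMl//.
Qed.

(* The substitution [y = x + e v] makes both sides of
   [integral_expRN_norm_swap] converge as [e] tends to [0]. *)
Lemma integral_cos_expRN_swap e x : 0 < e ->
  (\int[mu]_t (expR (- (e * `|t|)) * cos (x * t) / (1 + t ^+ 2))%:E
   = \int[mu]_v (expR (- `|x + e * v|) / (1 + v ^+ 2))%:E)%E.
Proof.
move=> e0.
have En0 t : 0 <= expR (- `|t|) by exact: expR_ge0.
have E1 t : `|expR (- (e * `|t|))| <= 1.
  by rewrite ger0_norm ?expR_ge0// -expR0 ler_expR oppr_le0 mulr_ge0// ltW.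
have cE : continuous (fun t : R => expR (- `|t|)).
  by have := continuous_expRN_norm (e := 1); under eq_fun do rewrite mul1r.
have iA : mu.-integrable setT
    (fun t => (expR (- (e * `|t|)) * cos (x * t) / (1 + t ^+ 2))%:E).
  apply: integrable_oneDsqr.
    apply: continuous_measurable_fun => t; apply: cvgM.
      exact: continuous_expRN_norm.
    by apply/differentiable_continuous/derivable1_diffP; exact: ex_derive.
  by move=> t; rewrite normrM mulr_ile1// ler_norml cos_geN1 cos_le1.
have iB : mu.-integrable setT
    (fun v => (expR (- `|x + e * v|) / (1 + v ^+ 2))%:E).
  apply: integrable_oneDsqr.
    apply: continuous_measurable_fun => t.
    apply: (@continuous_comp _ _ _ (fun v => x + e * v) (fun t => expR (- `|t|))).
      by apply/differentiable_continuous/derivable1_diffP; exact: ex_derive.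
    exact: cE.
  by move=> t; rewrite ger0_norm// -expR0 ler_expR oppr_le0.
have exp_int e' : 0 < e' ->
    (\int[mu]_t (expR (- (e' * `|t|)))%:E = (2 / e')%:E)%E.
  move=> e'0; have := @integral_expRN_norm_cos e' 0 0 0 e'0.
  rewrite normr0 ler01 !mul0r addr0 => <- //.
  by apply: eq_integral => t _; rewrite mul0r addr0 mulr1.
have mexp e' : measurable_fun setT (fun t : R => expR (- (e' * `|t|))).
  by apply: continuous_measurable_fun; exact: continuous_expRN_norm.
have iE : mu.-integrable setT (fun t : R => (expR (- (e * `|t|)))%:E).
  apply/integrableP; split; first by apply/measurable_EFinP; exact: mexp.
  under eq_integral => t _.
    rewrite gee0_abs ?lee_fin ?expR_ge0//.
    over.
  by rewrite exp_int// ltry.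
(* Both sides contain [4 / e]: twice the integral of [exp (- e |t|)] on the left, [2 / e] times that
   of [exp (- |y|)] on the right. For fixed [e] it is finite, so it cancels. *)
have := @integral_expRN_norm_swap e x e0.
rewrite (_ : (\int[mu]_t (_ * (2 + _))%:E = (4 / e)%:E +
    2%:E * \int[mu]_t (expR (- (e * `|t|)) * cos (x * t) / (1 + t ^+ 2))%:E)%E);
  last first.
  rewrite (_ : (4 / e)%:E = 2%:E * (2 / e)%:E)%E; last first.
    by rewrite -EFinM; congr EFin; field; rewrite gt_eqF.
  rewrite -(exp_int _ e0) -!integralZl// -integralD//; try exact: integrableZl.
  by apply: eq_integral => t _; rewrite -!EFinM -EFinD; congr EFin; ring.
rewrite [RHS](_ : _ = (4 / e)%:E +
    2%:E * \int[mu]_v (expR (- `|x + e * v|) / (1 + v ^+ 2))%:E)%E; last first.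
  (* The second factor is [2 pi] times the Poisson kernel of width [e] centred at [x]; the
     substitution rescales it to width [1]. *)
  pose G (y : R) := expR (- `|y|) * (2 * e / (e ^+ 2 + (y - x) ^+ 2)).
  have d0 (y : R) : 0 < e ^+ 2 + y ^+ 2.
    by rewrite ltr_pwDl ?sqr_ge0// exprn_gt0.
  have G0 y : 0 <= G y.
    by rewrite !mulr_ge0 ?invr_ge0// ltW.
  have cd : continuous (fun y : R => e ^+ 2 + (y - x) ^+ 2).
    by move=> y; apply/differentiable_continuous/derivable1_diffP; exact: ex_derive.
  have cG : continuous G.
    move=> y; apply: cvgM; first exact: cE.
    apply: cvgM; first exact: cvg_cst.
    apply: cvgV; first by rewrite gt_eqF.
    exact: cd.
  have -> : (\int[mu]_v (expR (- `|v|) * (2 / e + 2 * e / (e ^+ 2 + (v - x) ^+ 2)))%:E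
     = (2 / e)%:E * \int[mu]_v (expR (- (1 * `|v|)))%:E + \int[mu]_v (G v)%:E)%E.
    have c2 : continuous (fun v : R => 2 / e * expR (- (1 * `|v|))).
      by move=> v; apply: cvgM; [exact: cvg_cst|exact: continuous_expRN_norm].
    have e20 : 0 <= 2 / e by rewrite divr_ge0// ltW.
    rewrite -(ge0_integralZl_continuous _ e20 (continuous_expRN_norm (e := 1))
      (fun=> expR_ge0 _))//.
    rewrite -(@ge0_integralD _ _ _ mu setT measurableT
      (fun v => (2 / e * expR (- (1 * `|v|)))%:E) (EFin \o G)).
    - apply: eq_integral => v _; rewrite -EFinD; congr EFin.
      by rewrite /G mul1r mulrDr mulrC.
    - by move=> v _; rewrite lee_fin mulr_ge0 ?expR_ge0.
    - apply/measurable_EFinP; have := continuous_measurable_fun c2; exact.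
    - by move=> v _; rewrite lee_fin.
    - apply/measurable_EFinP; have := continuous_measurable_fun cG; exact.
  rewrite exp_int// -EFinM divr1; congr (_%:E + _)%E; first by field; rewrite gt_eqF.
  have dF (v : R) : is_derive v 1 (fun v => x + e * v) e.
    by apply: is_derive_eq; rewrite /GRing.scale /=; ring.
  have F'E : derive1 (fun v : R => x + e * v) = cst e.
    by apply/funext => v; rewrite derive1E derive_val.
  rewrite (@increasing_ge0_integration_by_substitutionT _ (fun v => x + e * v))//.
  - rewrite -integralZl//; apply: eq_integral => v _.
    rewrite -EFinM; congr EFin; rewrite F'E /=.
    rewrite [LHS](_ : _ = G (x + e * v) * e)// /G (addrAC x) subrr add0r exprMn.
    have v0 : 1 + v ^+ 2 != 0 by rewrite gt_eqF// ltr_pwDl ?sqr_ge0.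
    by field; rewrite v0 gt_eqF.
  - by move=> a b ab; rewrite ltrD2l ltr_pM2l.
  - by rewrite F'E => ?; exact: cst_continuous.
  - by rewrite F'E; exact: is_cvg_cst.
  - by rewrite F'E; exact: is_cvg_cst.
  - apply: (cvg_comp (fun v => e * v) (fun v => x + v)).
      by apply: gt0_cvgMrNy => //; exact: cvg_id.
    exact: cvg_addrl_Ny.
  - apply: (cvg_comp (fun v => e * v) (fun v => x + v)); last exact: cvg_addrl.
    by apply: gt0_cvgMry => //; exact: cvg_id.
(* Both remaining integrals are finite, so the cancellation can take place in [R]. *)
rewrite -(fineK (integrable_fin_num _ iA))// -(fineK (integrable_fin_num _ iB))//.
rewrite -!EFinM -!EFinD => -[] /addrI /mulfI ->//.
Qed.

Lemma measurable_cosM x : measurable_fun setT (fun t : R => cos (x * t)).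
Proof.
apply: continuous_measurable_fun => t.
by apply/differentiable_continuous/derivable1_diffP; exact: ex_derive.
Qed.

Lemma measurable_sinM x : measurable_fun setT (fun t : R => sin (x * t)).
Proof.
apply: continuous_measurable_fun => t.
by apply/differentiable_continuous/derivable1_diffP; exact: ex_derive.
Qed.

(** In [integral_cos_expRN_swap], [e] runs through [harmonic n], which tends to [0]. Both integrands
    are dominated by [1 / (1 + t^2)]; the left one tends to the integrand sought, the right one to
    [exp (- |x|) / (1 + t^2)]. *)
Lemma integral_cos_oneDsqr x :
  (\int[mu]_t (cos (x * t) / (1 + t ^+ 2))%:E = (pi * expR (- `|x|))%:E)%E.
Proof.
pose A n t := (expR (- (harmonic n * `|t|)) * cos (x * t) / (1 + t ^+ 2))%:E.
pose B n v := (expR (- `|x + harmonic n * v|) / (1 + v ^+ 2))%:E.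
have cN e : continuous (fun t : R => expR (- `|x + e * t|)).
  move=> t; apply: (cvg_comp (fun t => - `|x + e * t|) expR); last first.
    exact: continuous_expR.
  apply: cvgN; apply: cvg_norm; apply: cvgD; first exact: cvg_cst.
  by apply: cvgMl_tmp; exact: cvg_id.
have N1 t : `|expR (- `|t|)| <= 1 :> R.
  by rewrite ger0_norm ?expR_ge0// -expR0 ler_expR oppr_le0.
have w0 t : 0 <= (1 + t ^+ 2)^-1 :> R by rewrite invr_ge0 addr_ge0 ?sqr_ge0.
have dom f : (forall t, `|f t| <= 1) -> forall t,
    (`|(f t / (1 + t ^+ 2))%:E| <= ((1 + t ^+ 2)^-1)%:E)%E.
  by move=> f1 t; rewrite lee_fin normrM (ger0_norm (w0 t)) ler_piMl.
have cvgA : (\int[mu]_t A n t)%E @[n --> \oo] -->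
    (\int[mu]_t (cos (x * t) / (1 + t ^+ 2))%:E)%E.
  apply: (dominated_cvg _ _ _ _ integrable_oneDsqrV) => //.
  - move=> n; apply/measurable_EFinP; apply: measurable_funM; last first.
      exact: measurable_oneDsqrV.
    apply: measurable_funM; last exact: measurable_cosM.
    by apply: continuous_measurable_fun; exact: continuous_expRN_norm.
  - move=> t _; apply: cvg_EFin; first exact: nearW.
    apply: cvgM; last exact: cvg_cst.
    rewrite -[X in _ --> X]mul1r; apply: cvgM; last exact: cvg_cst.
    rewrite -expR0.
    apply: (cvg_comp (fun n => - (harmonic n * `|t|)) expR); last first.
      exact: continuous_expR.
    have : - (harmonic n * `|t|) @[n --> \oo] --> - (0 * `|t|).
      by apply: cvgN; apply: cvgMr_tmp; exact: cvg_harmonic.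
    by rewrite mul0r oppr0.
  - move=> n t _; apply: (dom (fun t => expR (- (harmonic n * `|t|)) * cos (x * t))).
    move=> s; rewrite normrM mulr_ile1// ?ler_norml ?cos_geN1 ?cos_le1//.
    have -> : harmonic n * `|s| = `|harmonic n * s|.
      by rewrite normrM (ger0_norm (harmonic_ge0 _)).
    by have := N1 (harmonic n * s); rewrite ler_norml.
have cvgB : (\int[mu]_t B n t)%E @[n --> \oo] -->
    (\int[mu]_t (expR (- `|x|) / (1 + t ^+ 2))%:E)%E.
  apply: (dominated_cvg _ _ _ _ integrable_oneDsqrV) => //.
  - move=> n; apply/measurable_EFinP; apply: measurable_funM; last first.
      exact: measurable_oneDsqrV.
    by apply: continuous_measurable_fun; exact: cN.
  - move=> t _; apply: cvg_EFin; first exact: nearW.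
    apply: cvgM; last exact: cvg_cst.
    apply: (cvg_comp (fun n => - `|x + harmonic n * t|) expR); last first.
      exact: continuous_expR.
    have : - `|x + harmonic n * t| @[n --> \oo] --> - `|x + 0 * t|.
      apply: cvgN; apply: cvg_norm; apply: cvgD; first exact: cvg_cst.
      by apply: cvgMr_tmp; exact: cvg_harmonic.
    by rewrite mul0r addr0.
  - by move=> n t _; apply: (dom (fun t => expR (- `|x + harmonic n * t|))) => s.
have AB n : (\int[mu]_t A n t = \int[mu]_t B n t)%E.
  by rewrite integral_cos_expRN_swap// harmonic_gt0.
have {}cvgB : (\int[mu]_t A n t)%E @[n --> \oo] -->
    (\int[mu]_t (expR (- `|x|) / (1 + t ^+ 2))%:E)%E.
  by rewrite (_ : (fun n => _) = fun n => (\int[mu]_t B n t)%E)//; apply/funext.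
rewrite (cvg_unique _ cvgA cvgB)//.
under eq_integral do rewrite EFinM.
by rewrite integralZl ?integral_oneDsqrV//;
  [rewrite -EFinM mulrC|exact: integrable_oneDsqrV].
Qed.

(** The integrand is odd. Adding [1 / (1 + t^2)] makes it nonnegative, so that folding applies and
    cancels the sine; the integral [pi] of the added term is then subtracted. *)
Lemma integral_sin_oneDsqr x :
  (\int[mu]_t (sin (x * t) / (1 + t ^+ 2))%:E = 0)%E.
Proof.
have sin1 (t : R) : `|sin (x * t)| <= 1 by rewrite ler_norml sin_geN1 sin_le1.
have isin : mu.-integrable setT (fun t => (sin (x * t) / (1 + t ^+ 2))%:E).
  by apply: integrable_oneDsqr => //; exact: measurable_sinM.
have w0 t : 0 <= (1 + t ^+ 2)^-1 :> R by rewrite invr_ge0 addr_ge0 ?sqr_ge0.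
have csin : continuous (fun t : R => sin (x * t)).
  by move=> t; apply/differentiable_continuous/derivable1_diffP; exact: ex_derive.
have H : (\int[mu]_t ((1 + t ^+ 2)^-1)%:E +
   \int[mu]_t (sin (x * t) / (1 + t ^+ 2))%:E = pi%:E)%E.
  rewrite -integralD//; last exact: integrable_oneDsqrV.
  under eq_integral do rewrite -EFinD -[X in X + _]mul1r -mulrDl.
  rewrite ge0_integralT_fold.
  - under eq_integral => t _.
      rewrite sqrrN mulrN sinN -mulrDl addrACA subrr addr0.
      over.
    rewrite ge0_integralZl_continuous//; last exact: continuous_oneDsqrV.
    rewrite integral0y_oneDsqr -EFinM; congr EFin.
    by rewrite mulrCA divff// mulr1.
  - move=> t; apply: cvgM; last exact: continuous_oneDsqrV.
    apply: cvgD; first exact: cvg_cst.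
    exact: csin.
  - move=> t; rewrite mulr_ge0//.
move: H; rewrite integral_oneDsqrV -(fineK (integrable_fin_num _ isin))//.
by rewrite -EFinD => -[] /(canRL (addKr _)); rewrite addNr => ->.
Qed.

(** Integrability travels with the value, so that linearity needs no side conditions. *)
Definition has_integral f x := mu.-integrable setT (EFin \o f) /\
  (\int[mu]_t (f t)%:E = x%:E)%E.

Lemma has_integralD f g x y : has_integral f x -> has_integral g y ->
  has_integral (fun t => f t + g t) (x + y).
Proof.
move=> [fi fx] [gi gy]; split.
  rewrite (_ : EFin \o _ = (EFin \o f) \+ (EFin \o g)); last exact/funext.
  exact: integrableD.
under eq_integral do rewrite EFinD.
by rewrite integralD// fx gy EFinD.
Qed.

Lemma has_integralZ k f x : has_integral f x ->
  has_integral (fun t => k * f t) (k * x).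
Proof.
move=> [fi fx]; split.
  rewrite (_ : EFin \o _ = fun t => k%:E * (EFin \o f) t)%E; last exact/funext.
  exact: integrableZl.
under eq_integral do rewrite EFinM.
by rewrite integralZl// fx EFinM.
Qed.

Lemma has_integral_sum (s : seq nat) (F : nat -> R -> R) (X : nat -> R) :
  (forall n, has_integral (F n) (X n)) ->
  has_integral (fun t => \sum_(n <- s) F n t) (\sum_(n <- s) X n).
Proof.
move=> FX; elim: s => [|n s IHs].
  rewrite big_nil; under [X in has_integral X]eq_fun do rewrite big_nil.
  split; last by rewrite integral0.
  exact: integrable0.
rewrite big_cons; under [X in has_integral X]eq_fun do rewrite big_cons.
exact: has_integralD.
Qed.

Lemma has_integral_cos x :
  has_integral (fun t => cos (x * t) / (1 + t ^+ 2)) (pi * expR (- `|x|)).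
Proof.
split; last exact: integral_cos_oneDsqr.
apply: integrable_oneDsqr; first exact: measurable_cosM.
by move=> t; rewrite ler_norml cos_geN1 cos_le1.
Qed.

Lemma has_integral_sin x : has_integral (fun t => sin (x * t) / (1 + t ^+ 2)) 0.
Proof.
split; last exact: integral_sin_oneDsqr.
apply: integrable_oneDsqr; first exact: measurable_sinM.
by move=> t; rewrite ler_norml sin_geN1 sin_le1.
Qed.

(** The two sums are the real and imaginary parts of the sum of [(u n + i v n) exp (- i L n t)]. In
    the expanded squared modulus the pair [m, n] contributes a cosine and a sine of [(L m - L n) t],
    and the sines integrate to [0]. *)
Lemma has_integral_trig_sqr (s : seq nat) (u v L : nat -> R) :
  has_integral (fun t =>
    ((\sum_(n <- s) (u n * cos (L n * t) + v n * sin (L n * t))) ^+ 2 +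
     (\sum_(n <- s) (v n * cos (L n * t) - u n * sin (L n * t))) ^+ 2) /
    (1 + t ^+ 2))
  (\sum_(m <- s) \sum_(n <- s)
     (u m * u n + v m * v n) * (pi * expR (- `|L m - L n|))).
Proof.
pose F m n t := (u m * u n + v m * v n) * (cos ((L m - L n) * t) / (1 + t ^+ 2)) +
  (v m * u n - u m * v n) * (sin ((L m - L n) * t) / (1 + t ^+ 2)).
have FX m n : has_integral (F m n)
    ((u m * u n + v m * v n) * (pi * expR (- `|L m - L n|))).
  rewrite -[X in has_integral _ X]addr0 -(mulr0 (v m * u n - u m * v n)).
  apply: has_integralD; apply: has_integralZ.
    exact: has_integral_cos.
  exact: has_integral_sin.
have := has_integral_sum s (fun m => has_integral_sum s (FX m)).
congr has_integral; apply/funext => t.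
rewrite expr2 expr2 !mulr_suml -big_split mulr_suml; apply: eq_bigr => m _ /=.
rewrite !mulr_sumr -big_split mulr_suml; apply: eq_bigr => n _ /=.
by rewrite /F !mulrBl cosB sinB; ring.
Qed.

End real_integrals.

Section dirichlet.
Local Open Scope classical_set_scope.
Local Open Scope complex_scope.
Context {R : realType}.
Let mu := @lebesgue_measure R.
Local Notation L n := (ln (n%:R : R)).

(** * The Schur test *)

Lemma expR_ln_nat n : (0 < n)%N -> expR (L n) = n%:R.
Proof. by move=> n0; rewrite lnK// posrE ltr0n. Qed.

Lemma expRN_ln_nat n : (0 < n)%N -> expR (- L n) = n%:R^-1.
Proof. by move=> n0; rewrite expRN expR_ln_nat. Qed.

(** The right-hand side is exactly [1 / (n^2 - 1/4)]. *)
Lemma inv_sqr_le_telescope n : (0 < n)%N ->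
  (n%:R ^+ 2)^-1 <= (n%:R - 2^-1)^-1 - (n.+1%:R - 2^-1)^-1 :> R.
Proof.
move=> n0; have n1 : 1 <= n%:R :> R by rewrite ler1n.
rewrite -[n.+1%:R]natr1; set x : R := n%:R in n1 *.
have -> : (x - 2^-1)^-1 - (x + 1 - 2^-1)^-1 = (x ^+ 2 - 4^-1)^-1.
  by field; apply/andP; split; [|apply/andP; split]; apply/eqP; nra.
by rewrite lef_pV2 ?posrE; nra.
Qed.

(** For positive [m] and [n] this is [m / max (m, n)^2]: the kernel [sqrt (m n) / max (m, n)^2]
    times the ratio [sqrt (m / n)] of the Schur weights. *)
Definition schur_weight (m n : nat) : R :=
  if (n <= m)%N then m%:R^-1 else m%:R / n%:R ^+ 2.

Lemma schur_weight_expR m n : (0 < m)%N -> (0 < n)%N ->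
  expR (- L n - `|L m - L n|) = schur_weight m n.
Proof.
move=> m0 n0; rewrite /schur_weight; case: leqP => mn.
  have Lmn : L n <= L m by rewrite ler_ln ?posrE ?ltr0n// ler_nat.
  rewrite ger0_norm ?subr_ge0// (_ : _ - _ = - L m); last by ring.
  exact: expRN_ln_nat.
have Lmn : L m <= L n by rewrite ler_ln ?posrE ?ltr0n// ler_nat ltnW.
rewrite ler0_norm ?subr_le0// (_ : - _ - _ = L m + (- L n + - L n)); last by ring.
by rewrite !expRD expRN_ln_nat// expR_ln_nat// expr2 invfM.
Qed.

(** The first [m] terms are [1 / m] and add up to [1]. The rest telescopes to at most
    [m / (m + 1/2) = 1 - 1 / (2m + 1)]; this gap below [2] is the source of the strict
    inequality. *)
Lemma schur_weight_sum m N : (0 < m)%N ->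
  \sum_(1 <= n < N) schur_weight m n <= 2 - (m.*2.+1%:R)^-1.
Proof.
move=> m0; have m1 : 1 <= m%:R :> R by rewrite ler1n.
have w0 n : 0 <= schur_weight m n.
  by rewrite /schur_weight; case: ifP => _; rewrite ?divr_ge0 ?invr_ge0 ?exprn_ge0.
have head : \sum_(1 <= n < m.+1) schur_weight m n = 1.
  rewrite (eq_big_nat _ _ (F2 := fun=> m%:R^-1)); last first.
    by move=> n /andP[_]; rewrite ltnS /schur_weight => ->.
  rewrite sumr_const_nat subSS subn0 -[_ *+ m]mulr_natr mulVf// pnatr_eq0.
  by rewrite -lt0n.
have tail k : \sum_(1 <= n < m.+1 + k) schur_weight m n <=
    1 + m%:R * ((m.+1%:R - 2^-1)^-1 - ((m.+1 + k)%:R - 2^-1)^-1).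
  elim: k => [|k IHk]; first by rewrite addn0 head subrr mulr0 addr0.
  rewrite addnS big_nat_recr ?addSn//=.
  have h : schur_weight m (m + k).+1 <= m%:R * (((m + k).+1%:R - 2^-1)^-1
     - ((m + k).+2%:R - 2^-1)^-1).
    rewrite /schur_weight ltnNge leq_addr /=.
    by rewrite ler_wpM2l// inv_sqr_le_telescope.
  by move: IHk; rewrite addSn; lra.
(* The terms are nonnegative, so the range may be enlarged to one that [tail] covers. *)
have NE : \sum_(1 <= n < N) schur_weight m n <=
    \sum_(1 <= n < m.+1 + N) schur_weight m n.
  case: N => [|N]; first by rewrite big_geq// sumr_ge0.
  rewrite (big_cat_nat (n := N.+1) (p := m.+1 + N.+1)) //= ?leq_addl//.
  by rewrite lerDl sumr_ge0.
apply: le_trans NE _; apply: le_trans (tail N) _.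
have : 0 <= ((m.+1 + N)%:R - 2^-1)^-1 :> R.
  by rewrite invr_ge0 natrD -[m.+1%:R]natr1; have : 0 <= N%:R :> R by []; nra.
have -> : (m.*2.+1%:R)^-1 = 1 - m%:R * (m.+1%:R - 2^-1)^-1 :> R.
  rewrite -[m.*2.+1%:R]natr1 -[m.+1%:R]natr1 -muln2 natrM; field.
  by apply/eqP; nra.
by move=> h; nra.
Qed.

Lemma schur_test (s : R) (x y : nat -> R) N : 2^-1 <= s ->
  \sum_(1 <= m < N) \sum_(1 <= n < N)
    ((x m * expR (- (s * L m))) * (x n * expR (- (s * L n))) +
     (y m * expR (- (s * L m))) * (y n * expR (- (s * L n)))) *
     expR (- `|L m - L n|) <=
  \sum_(1 <= m < N) (x m ^+ 2 + y m ^+ 2) * (2 - (m.*2.+1%:R)^-1).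
Proof.
move=> s2; pose A n := x n ^+ 2 + y n ^+ 2.
have A0 n : 0 <= A n by rewrite addr_ge0 ?sqr_ge0.
apply: (@le_trans _ _ (\sum_(1 <= m < N) \sum_(1 <= n < N)
  (2^-1 * (A m * schur_weight m n) + 2^-1 * (A n * schur_weight n m)))).
  rewrite !big_nat; apply: ler_sum => m /andP[m0 _].
  rewrite !big_nat; apply: ler_sum => n /andP[n0 _].
  have Lm : 0 <= L m by rewrite ln_ge0// ler1n.
  have Ln : 0 <= L n by rewrite ln_ge0// ler1n.
  (* [q] is [sqrt (m / n)], the ratio of the Schur weights, which balances the arithmetic-geometric
     mean inequality [amgm]. *)
  set q := expR ((L m - L n) / 2); have q0 : 0 < q by exact: expR_gt0.
  set K := expR (- (s * L m) - s * L n - `|L m - L n|).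
  have -> : (x m * expR (- (s * L m)) * (x n * expR (- (s * L n))) +
     y m * expR (- (s * L m)) * (y n * expR (- (s * L n)))) *
     expR (- `|L m - L n|) = K * (x m * x n + y m * y n).
    by rewrite /K !expRD; ring.
  have amgm (a b : R) : a * b <= 2^-1 * (a ^+ 2 * q + b ^+ 2 * q^-1).
    have := sqr_ge0 (a * q - b).
    have -> : a ^+ 2 * q + b ^+ 2 * q^-1 = (a ^+ 2 * q ^+ 2 + b ^+ 2) / q.
      by field; rewrite gt_eqF.
    by rewrite mulrA ler_pdivlMr//; nra.
  apply: (@le_trans _ _ (K * (2^-1 * (A m * q + A n * q^-1)))).
    rewrite ler_wpM2l ?expR_ge0// /A.
    by have := amgm (x m) (x n); have := amgm (y m) (y n); lra.
  (* The logarithms are nonnegative, so the worst abscissa is [s = 1/2]. *)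
  have KK : K <= expR (- (2^-1 * L m) - 2^-1 * L n - `|L m - L n|).
    rewrite ler_expR lerD2r lerB//; last by rewrite ler_wpM2r.
    by rewrite lerN2 ler_wpM2r.
  have Kq : K * q <= schur_weight m n.
    apply: (le_trans (ler_wpM2r (ltW q0) KK)).
    rewrite -expRD -schur_weight_expR// ler_expR le_eqVlt; apply/orP; left.
    by apply/eqP; field.
  have Kq' : K * q^-1 <= schur_weight n m.
    have qi0 : 0 <= q^-1 by rewrite invr_ge0 ltW.
    apply: (le_trans (ler_wpM2r qi0 KK)).
    rewrite /q -expRN -expRD -schur_weight_expR// distrC ler_expR.
    by rewrite le_eqVlt; apply/orP; left; apply/eqP; field.
  have := ler_wpM2l (A0 m) Kq; have := ler_wpM2l (A0 n) Kq'.
  by lra.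
(* Exchanging the sums in the second half turns it into the first, so only row sums remain. *)
under eq_bigr do rewrite big_split /=.
rewrite big_split /= [X in _ + X]exchange_big -big_split /=.
rewrite !big_nat; apply: ler_sum => m /andP[m0 _].
rewrite -!mulr_sumr -mulrDl -[X in X + X]mulr1 -mulrDr.
have -> : 2^-1 * (1 + 1) = 1 :> R by field.
by rewrite mul1r ler_wpM2l// schur_weight_sum.
Qed.

(** The summand is [1 / max (m, n)^2], so the double sum can be computed by growing the square one
    border at a time. *)
Lemma schur_test_sharp N :
  2 * (\sum_(1 <= n < N.+1) (n%:R^-1 : R)) - 2 <=
  \sum_(1 <= m < N.+1) \sum_(1 <= n < N.+1)
    (expR (- L m) * expR (- L n)) * expR (- `|L m - L n|).
Proof.
pose K (m n : nat) : R := ((maxn m n)%:R ^+ 2)^-1.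
have KE m n : (0 < m)%N -> (0 < n)%N ->
    expR (- L m) * expR (- L n) * expR (- `|L m - L n|) = K m n.
  move=> m0 n0; rewrite -mulrA -expRD schur_weight_expR// expRN_ln_nat//.
  have m0' : m%:R != 0 :> R by rewrite pnatr_eq0 -lt0n.
  rewrite /K /schur_weight; case: leqP => mn; last by rewrite mulrA mulVf// mul1r.
  by rewrite expr2 invfM.
rewrite [leRHS](eq_big_nat _ _ (F2 := fun m => \sum_(1 <= n < N.+1) K m n)); last first.
  by move=> m /andP[m0 _] /=; apply: eq_big_nat => n /andP[n0 _]; exact: KE.
(* The added term is the unspent part of the telescoping bound [2] for the sum of [1 / n^2]; at
   [N = 0] it equals [2]. *)
suff : 2 * (\sum_(1 <= n < N.+1) (n%:R^-1 : R)) - 2 + (N.+1%:R - 2^-1)^-1 <=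
    \sum_(1 <= m < N.+1) \sum_(1 <= n < N.+1) K m n.
  apply: le_trans; rewrite lerDl invr_ge0 subr_ge0.
  by apply: (@le_trans _ _ 1); [lra|rewrite ler1n].
elim: N => [|N IHN].
  by rewrite !big_geq// mulr0 sub0r (_ : (1 - 2^-1)^-1 = 2 :> R) ?addNr//; field.
(* The new border has [2 N + 1] entries [1 / (N + 1)^2], in total [2 / (N + 1) - 1 / (N + 1)^2];
   [inv_sqr_le_telescope] pays for the subtracted square. *)
rewrite big_nat_recr//= [leRHS]big_nat_recr//=.
under [in leRHS]eq_bigr do rewrite big_nat_recr//=.
rewrite big_split /= [X in _ <= _ + X]big_nat_recr//=.
have side F : (forall m, (0 < m <= N)%N -> F m = (N.+1%:R ^+ 2)^-1) ->
    \sum_(1 <= m < N.+1) F m = N%:R * (N.+1%:R ^+ 2)^-1 :> R.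
  move=> FE; rewrite (eq_big_nat _ _ (F2 := fun=> (N.+1%:R ^+ 2)^-1)); last first.
    by move=> m; rewrite ltnS; exact: FE.
  by rewrite sumr_const_nat subSS subn0 mulr_natl.
rewrite (side (fun m => K m N.+1)); last first.
  by move=> m /andP[_ mN]; rewrite /K (maxn_idPr _)// leqW.
rewrite (side (K N.+1)); last first.
  by move=> m /andP[_ mN]; rewrite /K (maxn_idPl _)// leqW.
rewrite /K maxnn; have := @inv_sqr_le_telescope N.+1 isT; move: IHN.
set H := \sum_(_ <= _ < _) _^-1; set D := \sum_(_ <= _ < _) _.
have : N.+1%:R^-1 = (N%:R + 1) * (N.+1%:R ^+ 2)^-1 :> R.
  by rewrite natr1 expr2 invfM mulrA divff ?mul1r ?pnatr_eq0.
set X := (N.+1%:R ^+ 2)^-1; set I0 := (N.+1%:R - _)^-1; set I1 := (N.+2%:R - _)^-1.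
set J := N.+1%:R^-1; clearbody J I0 I1 X D H.
lra.
Qed.

(** * Dirichlet polynomials *)

Lemma Re_normc_sqr (z : R[i]) :
  complex.Re `|z| ^+ 2 = complex.Re z ^+ 2 + complex.Im z ^+ 2.
Proof. by rewrite normc_def /= sqr_sqrtr// addr_ge0 ?sqr_ge0. Qed.

Lemma Re_sum (s : seq nat) (F : nat -> R[i]) :
  complex.Re (\sum_(n <- s) F n) = \sum_(n <- s) complex.Re (F n).
Proof. by apply: big_morph => // -[? ?] []. Qed.

Lemma Im_sum (s : seq nat) (F : nat -> R[i]) :
  complex.Im (\sum_(n <- s) F n) = \sum_(n <- s) complex.Im (F n).
Proof. by apply: big_morph => // -[? ?] []. Qed.

Lemma Re_le_normc (z : R[i]) (e : R) : `|z| < e%:C -> `|complex.Re z| < e.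
Proof. by move=> /(le_lt_trans (normc_ge_Re z)); rewrite ltcR. Qed.

Lemma Im_le_normc (z : R[i]) (e : R) : `|z| < e%:C -> `|complex.Im z| < e.
Proof.
move=> ze; rewrite -normrN -ReiNIm; apply: Re_le_normc.
by rewrite normrM [`|'i|]normc_def /= expr0n expr1n add0r sqrtr1 mulr1.
Qed.

(** * Convergence in [R[i]] by coordinates *)

Lemma cvg_Re {T : Type} {F : set_system T} {FF : Filter F} (f : T -> R[i]) (l : R[i]) :
  f x @[x --> F] --> l -> complex.Re (f x) @[x --> F] --> complex.Re l.
Proof.
move=> /cvgrPdist_lt fl; apply/cvgrPdist_lt => e e0.
have e0c : 0 < e%:C by rewrite ltcR.
apply: filterS (fl _ e0c) => x /Re_le_normc.
by case: l (f x) {fl} => ? ? [].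
Qed.

Lemma cvg_Im {T : Type} {F : set_system T} {FF : Filter F} (f : T -> R[i]) (l : R[i]) :
  f x @[x --> F] --> l -> complex.Im (f x) @[x --> F] --> complex.Im l.
Proof.
move=> /cvgrPdist_lt fl; apply/cvgrPdist_lt => e e0.
have e0c : 0 < e%:C by rewrite ltcR.
apply: filterS (fl _ e0c) => x /Im_le_normc.
by case: l (f x) {fl} => ? ? [].
Qed.

Lemma cvg_complex {T : Type} {F : set_system T} {FF : Filter F}
    (f : T -> R[i]) (l : R[i]) :
  complex.Re (f x) @[x --> F] --> complex.Re l ->
  complex.Im (f x) @[x --> F] --> complex.Im l -> f x @[x --> F] --> l.
Proof.
move=> /cvgrPdist_lt fRe /cvgrPdist_lt fIm; apply/cvgrPdist_lt => -[e i].
(* A positive element of [R[i]] has imaginary part [0], so the radius is real. *)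
rewrite ltcE /= => /andP[/eqP -> e0].
have e20 : 0 < e / 2 by rewrite divr_gt0.
apply: filterS2 (fRe _ e20) (fIm _ e20) => x xRe xIm; apply: (@le_lt_trans _ _
  (`|complex.Re l - complex.Re (f x)| + `|complex.Im l - complex.Im (f x)|)%:C).
  rewrite normc_def lecR.
  have -> : complex.Re (l - f x) = complex.Re l - complex.Re (f x).
    by case: l (f x) {fRe fIm xRe xIm} => ? ? [].
  have -> : complex.Im (l - f x) = complex.Im l - complex.Im (f x).
    by case: l (f x) {fRe fIm xRe xIm} => ? ? [].
  move: (complex.Re l - _) (complex.Im l - _) => a b.
  rewrite -(ler_pXn2r (n := 2)) ?nnegrE ?addr_ge0 ?sqrtr_ge0//.
  rewrite sqr_sqrtr ?addr_ge0 ?sqr_ge0// sqrrD !real_normK ?num_real//.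
  by rewrite lerD2r lerDl mulrn_wge0// mulr_ge0.
by rewrite ltcR (splitr e) ltrD.
Qed.

Lemma cvg_Re_normc_sqr {T : Type} {F : set_system T} {FF : Filter F}
    (f : T -> R[i]) (l : R[i]) :
  f x @[x --> F] --> l ->
  complex.Re `|f x| ^+ 2 @[x --> F] --> complex.Re `|l| ^+ 2.
Proof.
move=> fl; under eq_fun do rewrite Re_normc_sqr !expr2.
rewrite Re_normc_sqr !expr2; apply: cvgD; apply: cvgM;
  by [exact: cvg_Re|exact: cvg_Im].
Qed.

(** * Partial sums on vertical lines *)

Lemma natcpowNE n (s : R[i]) : natcpowN n s =
  (expR (- (complex.Re s * L n)) * cos (L n * complex.Im s))
  +i* (- (expR (- (complex.Re s * L n)) * sin (L n * complex.Im s))).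
Proof.
case: s => s t; rewrite /natcpowN /cexp /= !mulr0 subr0 add0r.
by rewrite cosN sinN mulrN (mulrC t).
Qed.

Definition dirichlet_sum (a : nat -> R[i]) (N : nat) (s : R[i]) : R[i] :=
  \sum_(1 <= n < N) a n * natcpowN n s.

Lemma Re_dirichlet_sum a N (s : R[i]) : complex.Re (dirichlet_sum a N s) =
  \sum_(1 <= n < N)
    (complex.Re (a n) * expR (- (complex.Re s * L n)) * cos (L n * complex.Im s) +
     complex.Im (a n) * expR (- (complex.Re s * L n)) * sin (L n * complex.Im s)).
Proof.
rewrite /dirichlet_sum Re_sum; apply: eq_bigr => n _; rewrite natcpowNE.
by case: (a n) => x y /=; ring.
Qed.

Lemma Im_dirichlet_sum a N (s : R[i]) : complex.Im (dirichlet_sum a N s) =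
  \sum_(1 <= n < N)
    (complex.Im (a n) * expR (- (complex.Re s * L n)) * cos (L n * complex.Im s) -
     complex.Re (a n) * expR (- (complex.Re s * L n)) * sin (L n * complex.Im s)).
Proof.
rewrite /dirichlet_sum Im_sum; apply: eq_bigr => n _; rewrite natcpowNE.
by case: (a n) => x y /=; ring.
Qed.

(** The weight is the same on every vertical line, so moving the line only damps the coefficients by
    [n^(-s)]. *)
Lemma has_integral_dirichlet_sum a N (s : R) :
  has_integral
    (fun t => complex.Re `|dirichlet_sum a N (s +i* t)| ^+ 2 / (1 + t ^+ 2))
    (pi * \sum_(1 <= m < N) \sum_(1 <= n < N)
      ((complex.Re (a m) * expR (- (s * L m))) *
       (complex.Re (a n) * expR (- (s * L n))) +
       (complex.Im (a m) * expR (- (s * L m))) *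
       (complex.Im (a n) * expR (- (s * L n)))) * expR (- `|L m - L n|)).
Proof.
have := @has_integral_trig_sqr R (index_iota 1 N)
  (fun n => complex.Re (a n) * expR (- (s * L n)))
  (fun n => complex.Im (a n) * expR (- (s * L n))) (fun n => L n).
congr has_integral.
  by apply/funext => t; rewrite Re_normc_sqr Re_dirichlet_sum Im_dirichlet_sum.
rewrite mulr_sumr; apply: eq_bigr => m _; rewrite mulr_sumr.
by apply: eq_bigr => n _; ring.
Qed.

(** The bound does not depend on [s], which permits the later passage to the critical line. *)
Lemma integral_dirichlet_sum_le a N (s : R) : 2^-1 <= s ->
  (\int[lebesgue_measure]_t
     (complex.Re `|dirichlet_sum a N (s +i* t)| ^+ 2 / (1 + t ^+ 2))%:E <=
   (pi * \sum_(1 <= m < N) (complex.Re `|a m| ^+ 2) * (2 - (m.*2.+1%:R)^-1))%:E)%E.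
Proof.
move=> s2; rewrite (has_integral_dirichlet_sum a N s).2 lee_fin.
rewrite ler_wpM2l ?pi_ge0//; under [leRHS]eq_bigr do rewrite Re_normc_sqr.
exact: schur_test.
Qed.

(** * The upper bound *)

Section einf.
Local Open Scope ereal_scope.

Lemma le_limn_einf (u v : (\bar R)^nat) : (forall n, u n <= v n) ->
  limn_einf u <= limn_einf v.
Proof.
move=> uv; rewrite !limn_einf_lim; apply: lee_lim; try exact: is_cvg_einfs.
apply: nearW => n; apply: le_ereal_inf_tmp => _ [m /= nm <-].
by apply: le_trans (uv m); apply: ereal_inf_lbound; exists m.
Qed.

Lemma limn_einf_cst (c : \bar R) : limn_einf (cst c : (\bar R)^nat) = c.
Proof. exact: (cvg_limn_einf_sup (cvg_cst c)).1. Qed.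

(** A lower limit is the opposite of the upper limit of the opposites. *)
Lemma measurable_fun_limn_einf (f : nat -> R -> \bar R) :
  (forall n, measurable_fun setT (f n)) ->
  measurable_fun setT (fun x => limn_einf (f ^~ x)).
Proof.
move=> mf; apply: measurableT_comp => //.
by apply: measurable_fun_limn_esup => n; exact: measurableT_comp.
Qed.

(* The smaller function need not be measurable: the integral of a nonnegative
   function is a supremum over simple functions. *)
Lemma ge0_le_integralT (f g : R -> \bar R) : (forall x, 0 <= f x) ->
  (forall x, f x <= g x) -> \int[mu]_x f x <= \int[mu]_x g x.
Proof.
move=> f0 fg; rewrite !ge0_integralTE//; last by move=> x; exact: le_trans (fg x).
apply: ereal_sup_le => _ [h /= hf <-]; exists h => //= x.
exact: le_trans (fg x).
Qed.

Lemma fatou_le (f : nat -> R -> \bar R) (M : \bar R) :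
  (forall n, measurable_fun setT (f n)) -> (forall n x, 0 <= f n x) ->
  (forall n, \int[mu]_x f n x <= M) ->
  \int[mu]_x limn_einf (f ^~ x) <= M.
Proof.
move=> mf f0 fM; apply: le_trans (fatou _ _ _ _) _ => //.
by rewrite -[leRHS]limn_einf_cst; exact: le_limn_einf.
Qed.

End einf.

(** * Boundary values below lower limits *)

Definition weighted_sqr (z : R[i]) (t : R) : R :=
  complex.Re `|z| ^+ 2 / (1 + t ^+ 2).

Lemma weighted_sqr_ge0 z t : 0 <= weighted_sqr z t.
Proof. by rewrite divr_ge0 ?sqr_ge0// addr_ge0 ?sqr_ge0. Qed.

Lemma weighted_sqr0 t : weighted_sqr 0 t = 0.
Proof. by rewrite /weighted_sqr normr0 /= expr0n mul0r. Qed.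

Lemma cvg_weighted_sqr (t : R) (f : nat -> R[i]) (l : R[i]) :
  f n @[n --> \oo] --> l ->
  (weighted_sqr (f n) t)%:E @[n --> \oo] --> (weighted_sqr l t)%:E.
Proof.
move=> fl; apply: cvg_EFin; first exact: nearW.
by apply: cvgM; [exact: cvg_Re_normc_sqr|exact: cvg_cst].
Qed.

(* Where the series diverges, [limn] is the default value [0], so the inequality
   still holds. *)
Lemma dirichlet_le_limn_einf (a : nat -> R[i]) (s : R[i]) (t : R) :
  ((weighted_sqr (dirichlet a s) t)%:E <=
   limn_einf (fun N => (weighted_sqr (dirichlet_sum a N s) t)%:E))%E.
Proof.
have [cv|ncv] := pselect (cvgn (fun N => dirichlet_sum a N s)).
  by rewrite (cvg_limn_einf_sup (cvg_weighted_sqr (t := t) cv)).1.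
rewrite /dirichlet (_ : limn _ = 0) ?weighted_sqr0; last first.
  by apply: getPN => l Fl; apply: ncv; apply/cvg_ex; exists l.
rewrite -[leLHS]limn_einf_cst; apply: le_limn_einf => N.
by rewrite lee_fin weighted_sqr_ge0.
Qed.

(** A horizontal approach inside every Stolz angle at [t]; Fatou's lemma calls for a sequence. *)
Definition approach (t : R) (k : nat) : R[i] := (2^-1 + harmonic k) +i* t.

Lemma approach_stolz (f : R[i] -> R[i]) (t : R) (l : R[i]) :
  nontangential_limit f t l -> f (approach t k) @[k --> \oo] --> l.
Proof.
move=> /(_ 1 ltr01); apply: cvg_comp => P.
rewrite /within /= => nP.
have at_ : approach t k @[k --> \oo] --> critical_point t.
  apply: cvg_complex => /=; last exact: cvg_cst.
  rewrite -[X in _ --> X]addr0.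
  by apply: cvgD; [exact: cvg_cst|exact: cvg_harmonic].
have /= := at_ _ nP; rewrite /nbhs /=; apply: filterS => k; apply.
have h : 0 < harmonic k :> R := harmonic_gt0 k.
split; rewrite /approach /=; first by rewrite ltrDl; exact: h.
by rewrite subrr normr0 mul1r addrAC subrr add0r; exact: h.
Qed.

Lemma nontangential_limit_unique (f : R[i] -> R[i]) (t : R) (l l' : R[i]) :
  nontangential_limit f t l -> nontangential_limit f t l' -> l = l'.
Proof.
move=> /approach_stolz fl /approach_stolz fl'.
exact: (cvg_unique (@norm_hausdorff _ R[i]) fl fl').
Qed.

(** Where a nontangential limit exists, it is the limit along [approach]. Elsewhere the boundary
    value is the default [0], and nonnegativity suffices. *)
Lemma boundary_value_le_limn_einf (f : R[i] -> R[i]) (t : R) :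
  ((weighted_sqr (boundary_value f t) t)%:E <=
   limn_einf (fun k => (weighted_sqr (f (approach t k)) t)%:E))%E.
Proof.
rewrite /boundary_value; case: xgetP => [l _ /approach_stolz fl|_].
  by rewrite (cvg_limn_einf_sup (cvg_weighted_sqr (t := t) fl)).1.
rewrite weighted_sqr0 -[leLHS]limn_einf_cst; apply: le_limn_einf => N.
by rewrite lee_fin weighted_sqr_ge0.
Qed.

(** Fatou's lemma is applied twice: over [k], as the line moves to the critical one, and inside it
    over [N], for the partial sums on a fixed line. *)
Lemma integral_boundary_value_le (a : nat -> R[i]) (M : R) :
  (forall N, \sum_(1 <= m < N) (complex.Re `|a m| ^+ 2) * (2 - (m.*2.+1%:R)^-1) <= M) ->
  (\int[mu]_t (weighted_sqr (boundary_value (dirichlet a) t) t)%:E <= (pi * M)%:E)%E.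
Proof.
move=> aM.
pose G k N t := (weighted_sqr (dirichlet_sum a N (approach t k)) t)%:E.
have G0 k N t : (0 <= G k N t)%E by rewrite lee_fin weighted_sqr_ge0.
have mG k N : measurable_fun setT (G k N).
  have [iG _] := has_integral_dirichlet_sum a N (2^-1 + harmonic k).
  exact: measurable_int iG.
have L0 k t : (0 <= limn_einf (G k ^~ t))%E.
  by rewrite -[leLHS]limn_einf_cst; exact: le_limn_einf.
apply: (@le_trans _ _
  (\int[mu]_t (limn_einf (fun k => limn_einf (G k ^~ t))))%E).
  apply: ge0_le_integralT => t; first by rewrite lee_fin weighted_sqr_ge0.
  apply: (le_trans (boundary_value_le_limn_einf _ _)).
  by apply: le_limn_einf => k; exact: dirichlet_le_limn_einf.
apply: fatou_le => //; first by move=> k; exact: measurable_fun_limn_einf.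
move=> k; apply: fatou_le => // N.
apply: le_trans (integral_dirichlet_sum_le _ _ _) _.
  by rewrite lerDl harmonic_ge0.
by rewrite lee_fin ler_wpM2l ?pi_ge0.
Qed.

Lemma boundary_norm_lt (a : nat -> R[i]) (n : nat) : H2 a -> (0 < n)%N -> a n <> 0 ->
  (boundary_norm (dirichlet a) < (Num.sqrt 2)%:E * H2_norm a)%E.
Proof.
move=> H2a n0 an0; pose A m := complex.Re `|a m| ^+ 2.
(* The gap that the nonzero coefficient [a n] leaves in the Schur test. Being independent of [N], it
   survives both limits. *)
pose d : R := A n * (n.*2.+1%:R)^-1.
have A0 m : 0 <= A m by rewrite sqr_ge0.
have An : 0 < A n.
  rewrite /A Re_normc_sqr lt_neqAle addr_ge0 ?sqr_ge0// andbT eq_sym.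
  rewrite paddr_eq0 ?sqr_ge0// !sqrf_eq0; apply/negP => /andP[/eqP rz /eqP iz].
  by apply: an0; case: (a n) rz iz => x y /= -> ->.
have d0 : 0 < d by rewrite mulr_gt0// invr_gt0.
have S0 : (0 <= H2_sqnorm a)%E by apply: nneseries_ge0 => m _ _; rewrite lee_fin A0.
pose S := fine (H2_sqnorm a).
have SE : H2_sqnorm a = S%:E by rewrite fineK// ge0_fin_numE.
have AS N : \sum_(1 <= m < N) A m <= S.
  rewrite -lee_fin -SE -sumEFin.
  by apply: nneseries_lim_ge => m _ _; rewrite lee_fin A0.
have B N : \sum_(1 <= m < N) (A m) * (2 - (m.*2.+1%:R)^-1) <= 2 * S - d.
  have w0 m : 0 <= 2 - (m.*2.+1%:R)^-1 :> R.
    rewrite subr_ge0 (@le_trans _ _ 1)//; last by lra.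
    by rewrite invf_le1// ler1n.
  (* The range is enlarged so that it contains [n] even for small [N]. *)
  apply: (@le_trans _ _ (\sum_(1 <= m < N + n.+1) (A m) * (2 - (m.*2.+1%:R)^-1))).
    case: N => [|N]; first by rewrite big_geq// sumr_ge0// => i _; rewrite mulr_ge0.
    rewrite [leRHS](big_cat_nat (n := N.+1)) //= ?leq_addr//.
    by rewrite lerDl sumr_ge0// => i _; rewrite mulr_ge0.
  under eq_bigr do rewrite mulrBr.
  rewrite sumrB; apply: lerB.
    by rewrite -mulr_suml mulrC ler_wpM2l.
  rewrite (bigD1_seq n) ?iota_uniq//=; last first.
    by rewrite mem_index_iota n0/= addnS ltnS leq_addl.
  by rewrite lerDl sumr_ge0// => i _; rewrite mulr_ge0// invr_ge0.
have S1 : 0 < S.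
  by apply: lt_le_trans (AS n.+1); rewrite big_nat_recr//= ltr_wpDl// sumr_ge0.
rewrite /H2_norm SE /= -EFinM -sqrtrM//.
apply: (@le_lt_trans _ _ (sqrte (2 * S - d)%:E)); last first.
  by rewrite /= lte_fin ltr_sqrt ?mulr_gt0// gtrBl.
rewrite lee_sqrt; last first.
  by have := B 1%N; rewrite big_geq// lee_fin.
rewrite -(mulKf (lt0r_neq0 (pi_gt0 R)) (2 * S - d)) EFinM.
apply: lee_wpmul2l; first by rewrite lee_fin invr_ge0 pi_ge0.
exact: integral_boundary_value_le.
Qed.

(** * Optimality of the constant *)

Lemma cvg_big_sum {T : Type} {F : set_system T} {FF : Filter F}
    (s : seq nat) (f : nat -> T -> R) (l : nat -> R) :
  (forall n, f n x @[x --> F] --> l n) ->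
  \sum_(n <- s) f n x @[x --> F] --> \sum_(n <- s) l n.
Proof.
move=> fl; elim: s => [|n s IHs].
  by rewrite big_nil; under eq_fun do rewrite big_nil; exact: cvg_cst.
by rewrite big_cons; under eq_fun do rewrite big_cons; exact: cvgD.
Qed.

Lemma continuous_dirichlet_sum (a : nat -> R[i]) N : continuous (dirichlet_sum a N).
Proof.
move=> s.
have FF : Filter (nbhs s) by exact: nbhs_filter.
have cRe : complex.Re z @[z --> s] --> complex.Re s.
  by exact: (@cvg_Re _ (nbhs s) _ id s cvg_id).
have cIm : complex.Im z @[z --> s] --> complex.Im s.
  by exact: (@cvg_Im _ (nbhs s) _ id s cvg_id).
have E n : expR (- (complex.Re z * L n)) @[z --> s] --> expR (- (complex.Re s * L n)).
  apply: (cvg_comp (fun z : R[i] => - (complex.Re z * L n)) expR); last first.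
    exact: continuous_expR.
  by apply: cvgN; apply: cvgM; [exact: cRe|exact: cvg_cst].
have LI n : L n * complex.Im z @[z --> s] --> L n * complex.Im s.
  by apply: cvgM; [exact: cvg_cst|exact: cIm].
have C n : cos (L n * complex.Im z) @[z --> s] --> cos (L n * complex.Im s).
  by apply: (cvg_comp (fun z : R[i] => L n * complex.Im z) cos (LI n));
    exact: continuous_cos.
have S n : sin (L n * complex.Im z) @[z --> s] --> sin (L n * complex.Im s).
  by apply: (cvg_comp (fun z : R[i] => L n * complex.Im z) sin (LI n));
    exact: continuous_sin.
apply: cvg_complex.
  under eq_fun do rewrite Re_dirichlet_sum; rewrite Re_dirichlet_sum.
  by apply: cvg_big_sum => n; apply: cvgD; apply: cvgM => //;
    apply: cvgM => //; exact: cvg_cst.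
under eq_fun do rewrite Im_dirichlet_sum; rewrite Im_dirichlet_sum.
by apply: cvg_big_sum => n; apply: cvgB; apply: cvgM => //;
    apply: cvgM => //; exact: cvg_cst.
Qed.

(** * Series with finitely many nonzero coefficients *)

Section dirichlet_polynomial.
Variables (a : nat -> R[i]) (N : nat).
Hypothesis aN : forall n, (N < n)%N -> a n = 0.

Lemma sum_finite_support (V : zmodType) (F : nat -> V) M :
  (forall n, (N < n)%N -> F n = 0) -> (N < M)%N ->
  \sum_(1 <= n < M) F n = \sum_(1 <= n < N.+1) F n.
Proof.
move=> F0 NM; rewrite (big_cat_nat (n := N.+1)) //=.
rewrite [X in _ + X]big_nat [X in _ + X]big1 ?addr0// => n /andP[Nn _].
exact: F0.
Qed.

Lemma dirichlet_polynomial : dirichlet a = dirichlet_sum a N.+1.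
Proof.
apply/funext => s; apply: lim_near_cst; first exact: norm_hausdorff.
near=> M; apply: sum_finite_support; last by near: M; exists N.+1.
by move=> n Nn; rewrite aN// mul0r.
Unshelve. all: by end_near. Qed.

Lemma H2_sqnorm_polynomial :
  H2_sqnorm a = (\sum_(1 <= n < N.+1) complex.Re `|a n| ^+ 2)%:E.
Proof.
apply: lim_near_cst => //; near=> M.
rewrite -(@sum_finite_support _ _ M) ?sumEFin//; last by near: M; exists N.+1.
by move=> n Nn; rewrite aN// normr0 /= expr0n.
Unshelve. all: by end_near. Qed.

Lemma boundary_value_polynomial t :
  boundary_value (dirichlet a) t = dirichlet_sum a N.+1 (critical_point t).
Proof.
have nt : nontangential_limit (dirichlet a) t
    (dirichlet_sum a N.+1 (critical_point t)).
  move=> M M0; rewrite dirichlet_polynomial; apply: cvg_within_filter.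
  exact: continuous_dirichlet_sum.
by apply: xget_unique => // l /nontangential_limit_unique; exact.
Qed.

(** For polynomials the norm is known exactly, which yields lower bounds for [C]. *)
Lemma boundary_norm_polynomial : boundary_norm (dirichlet a) =
  sqrte (\sum_(1 <= m < N.+1) \sum_(1 <= n < N.+1)
      ((complex.Re (a m) * expR (- (2^-1 * L m))) *
       (complex.Re (a n) * expR (- (2^-1 * L n))) +
       (complex.Im (a m) * expR (- (2^-1 * L m))) *
       (complex.Im (a n) * expR (- (2^-1 * L n)))) * expR (- `|L m - L n|))%:E.
Proof.
rewrite /boundary_norm; congr sqrte.
under eq_integral do rewrite boundary_value_polynomial.
by rewrite (has_integral_dirichlet_sum a N.+1 2^-1).2 -EFinM mulKf// lt0r_neq0// pi_gt0.
Qed.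

End dirichlet_polynomial.

(** The Schur weights [n^(-1/2)], cut off after [N]: for them the arithmetic-geometric mean step of
    [schur_test] is an equality. *)
Definition extremal_coef (N n : nat) : R[i] :=
  if (n <= N)%N then (expR (- (2^-1 * L n)))%:C else 0.

Lemma extremal_coef0 N n : (N < n)%N -> extremal_coef N n = 0.
Proof. by rewrite /extremal_coef ltnNge => /negbTE ->. Qed.

Lemma expRN_half n : expR (- (2^-1 * L n)) * expR (- (2^-1 * L n)) = expR (- L n).
Proof. by rewrite -expRD; congr expR; field. Qed.

Lemma sqrt2_optimal (C : R) :
  (forall a : nat -> R[i],
     H2 a -> (boundary_norm (dirichlet a) <= C%:E * H2_norm a)%E) ->
  Num.sqrt 2 <= C.
Proof.
move=> HC; pose H N := \sum_(1 <= n < N.+1) (n%:R^-1 : R).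
have main N : Num.sqrt (2 * H N - 2) <= C * Num.sqrt (H N).
  have HN : H2_sqnorm (extremal_coef N) = (H N)%:E.
    rewrite (H2_sqnorm_polynomial (@extremal_coef0 N)); congr EFin.
    apply: eq_big_nat => n /andP[n0]; rewrite ltnS => nN.
    rewrite Re_normc_sqr /extremal_coef nN /= expr0n addr0 expr2.
    by rewrite expRN_half expRN_ln_nat.
  have := HC (extremal_coef N); rewrite /H2 /H2_norm HN => /(_ (ltry _)).
  rewrite (boundary_norm_polynomial (@extremal_coef0 N)) /= lee_fin.
  apply: le_trans; apply: ler_wsqrtr.
  apply: (le_trans (schur_test_sharp N)).
  rewrite le_eqVlt; apply/orP; left; apply/eqP.
  apply: eq_big_nat => m /andP[m0]; rewrite ltnS => mN.
  apply: eq_big_nat => n /andP[n0]; rewrite ltnS => nN.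
  by rewrite /extremal_coef mN nN /= !mul0r addr0 !expRN_half.
(* If [C^2 < 2], then squaring [main] bounds every [H N] by [2 / (2 - C^2)], against the divergence
   of the harmonic series. *)
rewrite leNgt; apply/negP => C2.
have H1 N : (0 < N)%N -> 1 <= H N.
  case: N => // N _; rewrite /H big_nat_recl//= invr1 lerDl sumr_ge0//.
have C0 : 0 <= C.
  have := main 1%N; have := H1 1%N isT; move: (H 1%N) => h h1.
  have sh : 0 < Num.sqrt h by rewrite sqrtr_gt0; lra.
  by move=> /(le_trans (sqrtr_ge0 _)); rewrite pmulr_lge0.
have C22 : 0 < 2 - C ^+ 2.
  by rewrite subr_gt0 -[ltRHS](@sqr_sqrtr _ 2)// ltr_pXn2r// nnegrE sqrtr_ge0.
apply: (@dvg_harmonic R); apply: nondecreasing_is_cvgn.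
  apply/nondecreasing_seqP => n; rewrite seriesSr/= lerDl; exact: harmonic_ge0.
exists (2 / (2 - C ^+ 2)) => _ [N _ <-].
(* [harmonic k] is [1 / (k + 1)], so its first [N] terms are the [1 / n] with [1 <= n <= N]. *)
have -> : series harmonic N = H N.
  by rewrite /H /series /= big_add1.
rewrite ler_pdivlMr//.
case: N => [|N]; first by rewrite /H big_geq// mul0r.
have h1 := H1 N.+1 isT; have := main N.+1; move: (H N.+1) h1 => h h1.
(* If [2 h - 2 <= 0], then [h <= 1] and the bound is immediate; otherwise [main] may be squared,
   since [sqr_sqrtr] needs a nonnegative argument. *)
have [h2|h2] := leP (2 * h - 2) 0; first by nra.
rewrite -(ler_pXn2r (n := 2)) ?nnegrE ?sqrtr_ge0 ?mulr_ge0 ?sqrtr_ge0//.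
rewrite exprMn !sqr_sqrtr; [|lra|lra].
nra.
Qed.

End dirichlet.

Theorem mainTheorem1 (R : realType) :
  (forall a : nat -> R[i],
     H2 a -> (exists n : nat, (0 < n)%N /\ a n <> 0) ->
     (boundary_norm (dirichlet a) < (Num.sqrt 2)%:E * H2_norm a)%E)
  /\
  (forall C : R,
     (forall a : nat -> R[i],
        H2 a -> (boundary_norm (dirichlet a) <= C%:E * H2_norm a)%E) ->
     Num.sqrt 2 <= C).
Proof.
split=> [a H2a [n [n0 an0]]|C]; first exact: boundary_norm_lt an0.
exact: sqrt2_optimal.
Qed.
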